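(* Consider the patterns of length $3$, i.e. the six permutations $123,132,213,231,312,321\in S_3$. Then: (i) For the statistic $\mathrm{nes}$, the $\mathrm{nes}$-Wilf-equivalence classes of $S_3$ having more than one element are exactly $\{132,213\}$ and $\{231,312\}$ (all other patterns form singleton classes). (ii) For the statistic $\mathrm{crs}$, the only $\mathrm{crs}$-Wilf-equivalence class of $S_3$ having more than one element is $\{132,213,321\}$. (iii) For the pair of statistics $(\mathrm{crs},\mathrm{nes})$, the only $(\mathrm{crs},\mathrm{nes})$-Wilf-equivalence class of $S_3$ having more than one element is $\{132,213\}$.
   Context: $S_n$ is the set of permutations of $[n]=\{1,\dots,n\}$, written $\sigma=\sigma(1)\cdots\sigma(n)$. For a sequence of distinct integers, its reduction $\mathrm{red}$ is the permutation of $[k]$ in the same relative order. $\sigma\in S_n$ contains $\tau\in S_k$ if some subsequence $\sigma(i_1)\cdots\sigma(i_k)$, $i_1<\dots<i_k$, has reduction $\tau$; otherwise $\sigma$ avoids $\tau$. $S_n(T)$ is the set of permutations of $[n]$ avoiding every pattern in $T$. A crossing of $\sigma$ is a pair $(i,j)$ with $i<j<\sigma(i)<\sigma(j)$ or $\sigma(i)<\sigma(j)\le i<j$; a nesting is a pair $(i,j)$ with $i<j<\sigma(j)<\sigma(i)$ or $\sigma(j)<\sigma(i)\le i<j$. $\mathrm{crs}(\sigma)$ and $\mathrm{nes}(\sigma)$ denote the numbers of crossings and nestings. For statistics $\mathrm{st}_1,\dots,\mathrm{st}_k$, two sets of patterns $T,T'$ are $(\mathrm{st}_1,\dots,\mathrm{st}_k)$-Wilf-equivalent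 if for every $n\ge 1$, $\sum_{\sigma\in S_n(T)}\prod_i x_i^{\mathrm{st}_i(\sigma)}=\sum_{\sigma\in S_n(T')}\prod_i x_i^{\mathrm{st}_i(\sigma)}$. Classes here are the equivalence classes of this relation restricted to single patterns $\{\tau\}$, $\tau\in S_3$. *)

(* Defs.v *)
From HB Require Import structures.
From mathcomp Require Import all_boot all_order all_fingroup all_algebra.
From mathcomp Require Import mpoly.

Set Implicit Arguments.
Unset Strict Implicit.
Unset Printing Implicit Defensive.

Import GRing.Theory.

(* The permutations of [n] are 'S_n, acting on {0, ..., n-1}. One-line words
   are written with values in {1, ..., n}. *)
Definition word n (s : 'S_n) : seq nat := [seq (s i).+1 | i <- enum 'I_n].

(* Meaningful for sequences of distinct integers only: each entry is replaced
   by its rank. *)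
Definition red (w : seq nat) : seq nat :=
  [seq (count (fun y => y < x) w).+1 | x <- w].

Definition contains n k (s : 'S_n) (t : 'S_k) : bool :=
  [exists f : {ffun 'I_k -> 'I_n},
     [forall a : 'I_k, forall b : 'I_k, (a < b) ==> (f a < f b)]
     && (red [seq (s (f a)).+1 | a <- enum 'I_k] == word t)].

Definition avoids n k (s : 'S_n) (t : 'S_k) : bool := ~~ contains s t.

Definition pattern := {k : nat & 'S_k}.

Definition Pattern k (t : 'S_k) : pattern := existT (fun k => 'S_k) k t.

(* A set of patterns is given by a list; only its elements matter. *)
Definition Av n (T : seq pattern) : {set 'S_n} :=
  [set s : 'S_n | all (fun t : pattern => avoids s (tagged t)) T].

(* The conditions below only compare positions with values, so they do not
   depend on whether both are numbered from 0 or from 1. *)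
Definition crossing n (s : 'S_n) (i j : 'I_n) : bool :=
  [&& i < j, j < s i & s i < s j] || [&& s i < s j, s j <= i & i < j].

Definition nesting n (s : 'S_n) (i j : 'I_n) : bool :=
  [&& i < j, j < s j & s j < s i] || [&& s j < s i, s i <= i & i < j].

Definition statistic := forall n, 'S_n -> nat.

Definition crs : statistic := fun n s =>
  #|[set p : 'I_n * 'I_n | crossing s p.1 p.2]|.

Definition nes : statistic := fun n s =>
  #|[set p : 'I_n * 'I_n | nesting s p.1 p.2]|.

Definition genpoly m (st : m.-tuple statistic) n (T : seq pattern)
    : {mpoly int[m]} :=
  (\sum_(s in Av n T) \prod_(i < m) 'X_i ^+ tnth st i n s)%R.

Definition wilf_equiv m (st : m.-tuple statistic) (T T' : seq pattern) : Prop :=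
  forall n, 0 < n -> genpoly st n T = genpoly st n T'.

Definition is_wilf_class m (st : m.-tuple statistic) k (C : {set 'S_k}) : Prop :=
  exists t : 'S_k, forall t' : 'S_k,
    t' \in C <-> wilf_equiv st [:: Pattern t] [:: Pattern t'].

(* The permutation with one-line word w; the identity if w is not the word of
   a permutation. *)
Definition perm_of_word n (w : seq nat) : 'S_n.+1 :=
  insubd (1%g : 'S_n.+1) [ffun i : 'I_n.+1 => inord (nth 0 w i).-1].

Definition p123 : 'S_3 := perm_of_word 2 [:: 1; 2; 3].
Definition p132 : 'S_3 := perm_of_word 2 [:: 1; 3; 2].
Definition p213 : 'S_3 := perm_of_word 2 [:: 2; 1; 3].
Definition p231 : 'S_3 := perm_of_word 2 [:: 2; 3; 1].
Definition p312 : 'S_3 := perm_of_word 2 [:: 3; 1; 2].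
Definition p321 : 'S_3 := perm_of_word 2 [:: 3; 2; 1].

Lemma word_perm_of_word n (w : seq nat) :
  perm_eq w (iota 1 n.+1) -> word (perm_of_word n w) = w.
Proof.
move=> pw; have sw : size w = n.+1 by rewrite (perm_size pw) size_iota.
have uw : uniq w by rewrite (perm_uniq pw) iota_uniq.
have wlt (i : 'I_n.+1) : 0 < nth 0 w i <= n.+1.
  by have := mem_nth 0 (s := w) (n := i); rewrite sw ltn_ord => /(_ isT);
     rewrite (perm_mem pw) mem_iota add1n ltnS.
have inordK' (i : 'I_n.+1) : (inord (nth 0 w i).-1 : 'I_n.+1).+1 = nth 0 w i.
  by case/andP: (wlt i) => w0 wn; rewrite inordK prednK.
have inj : injectiveb [ffun i : 'I_n.+1 => inord (nth 0 w i).-1 : 'I_n.+1].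
  apply/injectiveP => i j; rewrite !ffunE => /(congr1 (fun x : 'I_n.+1 => x.+1)).
  rewrite !inordK' => /eqP; rewrite nth_uniq ?sw //.
  by move=> /eqP /val_inj.
apply: (@eq_from_nth _ 0); first by rewrite size_map size_enum_ord.
move=> k; rewrite size_map size_enum_ord => kn.
rewrite (nth_map ord0) ?size_enum_ord // /perm_of_word.
have -> : nth ord0 (enum 'I_n.+1) k = Ordinal kn.
  by apply: val_inj; rewrite /= nth_enum_ord.
have -> : insubd (1%g : 'S_n.+1) [ffun i : 'I_n.+1 => inord (nth 0 w i).-1]
    = Perm inj by apply: val_inj; rewrite insubdK.
by rewrite -pvalE /= ffunE inordK'.
Qed.

Lemma words_S3 :
  [/\ word p123 = [:: 1; 2; 3], word p132 = [:: 1; 3; 2],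
      word p213 = [:: 2; 1; 3] & word p231 = [:: 2; 3; 1]] /\
  word p312 = [:: 3; 1; 2] /\ word p321 = [:: 3; 2; 1].
Proof. by do ![split]; apply: word_perm_of_word. Qed.

(* Main.v *)
Require Import Defs.
From HB Require Import structures.
From mathcomp Require Import all_boot all_order all_fingroup all_algebra.
From mathcomp Require Import mpoly zify.

(** The reverse-complement-inverse of a permutation has the same numbers of
    crossings and nestings, and exchanges 132 and 213; inversion preserves
    nestings and exchanges 231 and 312.  Inequivalent patterns are already
    separated by S_4.

    The deep equivalence is 213 ~ 321 for crossings.  Every permutation satisfies
    crs + inv + exc = sum_i |s(i) - i|, so crs is a sum over the points of the
    diagram, minus the number of inversions, and it behaves well when points are
    deleted one at a time.  On both sides, points are deleted along a decision
    process that reads one row, deletes its point or not, and passes to the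
    inverse permutation.  The successive choices form a Dyck path of length 2n, a
    down step from height H contributing (H-1)/2 (rounded down) to crs.  For 321
    the rows and columns are read from the first one on.  For 213 they are read
    along the initial ascending runs of s and of its inverse, each of which ends
    with the maximum; this moves the diagonal with respect to which excedances are
    counted. *)

Set Implicit Arguments.
Unset Strict Implicit.
Unset Printing Implicit Defensive.

Import GRing.Theory Num.Theory.

Lemma sum_ord_in_Ico n a b : b <= n -> \sum_(j < n) ((a <= j) && (j < b)) = b - a.
Proof.
move=> le_bn; rewrite -[in RHS](minn_idPl le_bn).
by elim: n {le_bn} => [|n IHn]; rewrite ?big_ord0 ?big_ord_recr /= ?IHn; lia.
Qed.

Lemma sum_perm_lt n (s : 'S_n) a : a <= n -> \sum_(k < n) (s k < a) = a.
Proof.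
move=> le_an; rewrite -[RHS]subn0 -(sum_ord_in_Ico 0 le_an).
by rewrite [RHS](reindex_inj (@perm_inj _ s)).
Qed.

Lemma eqn_perm n (s : 'S_n) (i j : 'I_n) : (s i == s j :> nat) = (i == j :> nat).
Proof. by rewrite !val_eqE (inj_eq perm_inj). Qed.

Lemma ltn_rev_ord n (i j : 'I_n) : (rev_ord i < rev_ord j) = (j < i).
Proof. by have := ltn_ord i; have := ltn_ord j; rewrite /=; lia. Qed.

(** * Pattern containment *)

Lemma nth_word n (s : 'S_n) (i : 'I_n) : nth 0 (word s) i = (s i).+1.
Proof. by rewrite (nth_map i) ?size_enum_ord // nth_ord_enum. Qed.

Lemma word_inj n : injective (@word n).
Proof.
by move=> s t eq_st; apply/permP => i; apply/val_inj/succn_inj; rewrite /= -!nth_word eq_st.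
Qed.

Lemma red_eq_word k (t : 'S_k) (v : 'I_k -> nat) :
  red [seq v a | a <- enum 'I_k] = word t <-> forall a b, (v a < v b) = (t a < t b).
Proof.
pose rank x := \sum_b (v b < x).
have redE : red [seq v a | a <- enum 'I_k] = [seq (rank (v a)).+1 | a <- enum 'I_k].
  rewrite /red -map_comp; apply: eq_map => a /=; congr _.+1.
  by rewrite count_map -sumn_count sumnE big_map big_enum.
rewrite redE; split=> [/eq_in_map rankE a b | ltE]; last first.
  apply/eq_in_map => a _; congr _.+1; rewrite -[RHS](sum_perm_lt t) ?(ltnW (ltn_ord _)) //.
  by apply: eq_bigr => b _; rewrite ltE.
have {}rankE c : rank (v c) = t c by have [] := rankE c (mem_enum _ _).
have rank_le x y : x <= y -> rank x <= rank y.
  by move=> le_xy; apply: leq_sum => c _; case: ltnP => // /leq_trans->.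
rewrite -!rankE; case: (ltnP (v a)) => [lt_ab|/rank_le]; last by rewrite leqNgt => /negbTE->.
apply/esym; rewrite /rank (bigD1 a) //= [X in _ < X](bigD1 a) //= ltnn lt_ab ltnS.
by apply: leq_sum => c _; case: ltnP => // /ltn_trans->.
Qed.

Lemma containsP n k (s : 'S_n) (t : 'S_k) :
  reflect (exists f : 'I_k -> 'I_n,
             {mono f : a b / a < b} /\ {mono s \o f \o t^-1%g : a b / a < b})
          (contains s t).
Proof.
have orderE (f : 'I_k -> 'I_n) :
  {mono s \o f \o t^-1%g : a b / a < b} <-> red [seq (s (f a)).+1 | a <- enum 'I_k] = word t.
  rewrite red_eq_word; split=> [sft_mono a b|sf_mono a b].
    by rewrite ltnS -sft_mono /= !permK.
  by rewrite /= -[RHS]/(a < b) -{2}(permKV t a) -{2}(permKV t b) -sf_mono.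
apply: (iffP existsP) => [[f /andP[f_homo /eqP/orderE f_order]] | [f [f_mono /orderE f_order]]].
  exists f; split=> // a b; have {}f_homo (c d : 'I_k) : c < d -> f c < f d.
    by move: f_homo => /forallP/(_ c)/forallP/(_ d)/implyP.
  by case: (ltngtP a b) => [/f_homo|/f_homo/ltnW|/val_inj->]; rewrite ?ltnn // leqNgt => /negbTE.
exists (finfun f); rewrite (eq_map (g := fun a => (s (f a)).+1)) ?f_order ?eqxx ?andbT => [|a].
  by apply/forallP => a; apply/forallP => b; rewrite !ffunE f_mono; apply/implyP.
by rewrite ffunE.
Qed.

Lemma contains_inv n k (s : 'S_n) (t : 'S_k) : contains s^-1%g t^-1%g = contains s t.
Proof.
suff imp (u : 'S_n) (v : 'S_k) : contains u v -> contains u^-1%g v^-1%g.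
  by apply/idP/idP => /imp //; rewrite !invgK.
case/containsP => f [f_mono uf_mono]; apply/containsP; exists (u \o f \o v^-1%g).
by split=> // a b; rewrite invgK /= !permK f_mono.
Qed.

Lemma avoids_inv n k (s : 'S_n) (t : 'S_k) : avoids s^-1%g t^-1%g = avoids s t.
Proof. by rewrite /avoids contains_inv. Qed.

(* Reverse-complement-inverse: the reflection of the diagram in its antidiagonal. *)
Definition rci n (s : 'S_n) : 'S_n := (s^-1 ^ perm (@rev_ord_inj n))%g.

Lemma rciE n (s : 'S_n) i : rci s i = rev_ord (s^-1 (rev_ord i))%g.
Proof.
by rewrite -[i in LHS]rev_ordK -[rev_ord (rev_ord i)](permE (@rev_ord_inj n)) permJ permE.
Qed.

Lemma rci_rev n (s : 'S_n) i : rci s (rev_ord (s i)) = rev_ord i.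
Proof. by rewrite rciE rev_ordK permK. Qed.

Lemma rciK n : involutive (@rci n).
Proof.
move=> s; apply/permP => i.
by have := rci_rev (rci s) (rev_ord (s i)); rewrite (rci_rev s) !rev_ordK.
Qed.

Lemma contains_rci n k (s : 'S_n) (t : 'S_k) : contains (rci s) (rci t) = contains s t.
Proof.
suff imp (u : 'S_n) (v : 'S_k) : contains u v -> contains (rci u) (rci v).
  by apply/idP/idP => /imp //; rewrite !rciK.
case/containsP => f [f_mono uf_mono]; apply/containsP.
exists (fun a => rev_ord (u (f (v^-1 (rev_ord a))%g))); split=> a b.
  by rewrite ltn_rev_ord -[u _]/((u \o f \o v^-1%g) _) uf_mono ltn_rev_ord.
have rciV c : ((rci v)^-1 c)%g = rev_ord (v (rev_ord c)).
  by apply: (@perm_inj _ (rci v)); rewrite permKV rci_rev rev_ordK.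
by rewrite /= !rciV !rev_ordK !permK !rci_rev ltn_rev_ord f_mono ltn_rev_ord.
Qed.

Lemma avoids_rci n k (s : 'S_n) (t : 'S_k) : avoids (rci s) (rci t) = avoids s t.
Proof. by rewrite /avoids contains_rci. Qed.

Lemma ltn_lift n (a : 'I_n.+1) (i j : 'I_n) : (lift a i < lift a j) = (i < j).
Proof. by rewrite /= /bump; lia. Qed.

Lemma avoids_lift_perm n k (a b : 'I_n.+1) (s : 'S_n) (t : 'S_k) :
  avoids (lift_perm a b s) t -> avoids s t.
Proof.
apply: contra => /containsP[f [f_mono sf_mono]]; apply/containsP; exists (lift a \o f).
by split=> i j; rewrite /= ?lift_perm_lift ltn_lift; [apply: f_mono | apply: sf_mono].
Qed.

Lemma avoids_S3P n (s : 'S_n) (t : 'S_3) :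
  reflect (forall i j k : 'I_n, i < j -> j < k ->
             red [:: (s i).+1; (s j).+1; (s k).+1] != word t)
          (avoids s t).
Proof.
have enum3 (T : Type) (g : 'I_3 -> T) :
    [seq g a | a <- enum 'I_3] = [:: g (inord 0); g (inord 1); g (inord 2)].
  rewrite !enum_ordSl (_ : enum 'I_0 = [::]) /=; last by apply: size0nil; rewrite size_enum_ord.
  by congr [:: g _; g _; g _]; apply: val_inj; rewrite /= inordK.
apply: (iffP negP) => [no_t i j k lt_ij lt_jk | no_t].
  apply: contraPneq no_t => t_ijk; case.
  apply/existsP; exists [ffun a : 'I_3 => nth i [:: i; j; k] a].
  rewrite enum3 !ffunE !inordK //= t_ijk eqxx andbT.
  apply/forallP => a; apply/forallP => b; apply/implyP; rewrite !ffunE.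
  by case: a b => [[|[|[|a]]] la] [[|[|[|b]]] lb] //= _; apply: ltn_trans lt_jk.
case/existsP => f /andP[/forallP f_homo]; rewrite enum3; apply/negP/no_t.
  by have /forallP/(_ (inord 1))/implyP := f_homo (inord 0); apply; rewrite !inordK.
by have /forallP/(_ (inord 2))/implyP := f_homo (inord 1); apply; rewrite !inordK.
Qed.

Lemma words_S3E :
  (((word p123 = [:: 1; 2; 3]) * (word p132 = [:: 1; 3; 2]) * (word p213 = [:: 2; 1; 3])) *
   ((word p231 = [:: 2; 3; 1]) * (word p312 = [:: 3; 1; 2]) * (word p321 = [:: 3; 2; 1])))%type.
Proof. by case: words_S3 => -[-> -> -> ->] [-> ->]. Qed.

Lemma red_eq213 a b c : (red [:: a; b; c] == [:: 2; 1; 3]) = (b < a < c).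
Proof.
rewrite /red /= !eqseq_cons !ltnn andbT.
by case: (ltngtP a b); case: (ltngtP b c); case: (ltngtP a c) => //=; lia.
Qed.

Lemma red_eq321 a b c : (red [:: a; b; c] == [:: 3; 2; 1]) = (c < b < a).
Proof.
rewrite /red /= !eqseq_cons !ltnn andbT.
by case: (ltngtP a b); case: (ltngtP b c); case: (ltngtP a c) => //=; lia.
Qed.

Lemma avoids_p213P n (s : 'S_n) :
  reflect (forall i j k : 'I_n, i < j -> j < k -> ~~ (s j < s i < s k)) (avoids s p213).
Proof.
by apply: (iffP (avoids_S3P s p213)) => no213 i j k lt_ij /(no213 i j k lt_ij);
  rewrite words_S3E red_eq213.
Qed.

Lemma avoids_p321P n (s : 'S_n) :
  reflect (forall i j k : 'I_n, i < j -> j < k -> ~~ (s k < s j < s i)) (avoids s p321).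
Proof.
by apply: (iffP (avoids_S3P s p321)) => no321 i j k lt_ij /(no321 i j k lt_ij);
  rewrite words_S3E red_eq321.
Qed.

Lemma val_word n (s : 'S_n) (i : 'I_n) : s i = (nth 0 (word s) i).-1 :> nat.
Proof. by rewrite nth_word. Qed.

Lemma cancel_invg n (s t : 'S_n) : cancel s t -> (s^-1 = t)%g.
Proof. by move=> stK; apply/permP => i; rewrite -[in RHS](permKV s i) stK. Qed.

Local Ltac decide_S3 i :=
  apply: val_inj; rewrite /= ?val_word /= ?val_word !words_S3E; by case: i => -[|[|[|i]]].

Lemma invg_p132 : (p132^-1 = p132)%g.
Proof. by apply: cancel_invg => i; decide_S3 i. Qed.

Lemma invg_p213 : (p213^-1 = p213)%g.
Proof. by apply: cancel_invg => i; decide_S3 i. Qed.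

Lemma invg_p231 : (p231^-1 = p312)%g.
Proof. by apply: cancel_invg => i; decide_S3 i. Qed.

Lemma invg_p321 : (p321^-1 = p321)%g.
Proof. by apply: cancel_invg => i; decide_S3 i. Qed.

Lemma rci_p132 : rci p132 = p213.
Proof. by apply/permP => i; rewrite rciE invg_p132; decide_S3 i. Qed.

(** * Crossings, nestings, inversions, excedances *)

Definition ninv n (s : 'S_n) : nat :=
  \sum_(i < n) \sum_(j < n) ((i < j) && (s j < s i)).

Definition nexc n (s : 'S_n) : nat := \sum_(i < n) (i < s i).

Lemma card_pairE n (P : 'I_n -> 'I_n -> bool) :
  #|[set p : 'I_n * 'I_n | P p.1 p.2]| = \sum_i \sum_j P i j.
Proof.
rewrite cardsE -sum1_card big_mkcond pair_big /=.
by apply: eq_bigr => -[i j] _; rewrite unfold_in /=; case: (P i j).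
Qed.

Lemma sum_symmetrize n (f g : 'I_n -> 'I_n -> nat) :
  (forall i, f i i = g i i) ->
  (forall i j : 'I_n, i < j -> f i j + f j i = g i j + g j i) ->
  \sum_i \sum_j f i j = \sum_i \sum_j g i j.
Proof.
move=> eq_diag eq_sym; apply: double_inj; rewrite -!addnn.
rewrite [X in _ + X = _]exchange_big [X in _ = _ + X]exchange_big -!big_split /=.
apply: eq_bigr => i _; rewrite -!big_split; apply: eq_bigr => j _ /=.
case: (ltngtP i j) => [/eq_sym->|/eq_sym eq_ji|/val_inj->] //; last by rewrite eq_diag.
by rewrite addnC eq_ji addnC.
Qed.

(* Summed over all [j] both sides agree by reindexing along [s], and so do the
   contributions of the excedances [j], by exchanging the two arcs of a crossing. *)
Lemma sum_nonexc_under_exc n (s : 'S_n) :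
  \sum_(i < n) \sum_(j < n) [&& s j <= j, i < j & j < s i]
  = \sum_(i < n) \sum_(j < n) [&& s j <= j, i < s j & s j < s i].
Proof.
have eq_exc : \sum_(i < n) \sum_(j < n) [&& j < s j, i < j & j < s i]
    = \sum_(i < n) \sum_(j < n) [&& j < s j, i < s j & s j < s i].
  apply: sum_symmetrize => [i|i j lt_ij]; first by rewrite !ltnn !andbF.
  by have := eqn_perm s i j; case: (ltngtP (s i) (s j)) => ? ?; lia.
have eq_all : \sum_(i < n) \sum_(j < n) ((i < j) && (j < s i))
    = \sum_(i < n) \sum_(j < n) ((i < s j) && (s j < s i)).
  by apply: eq_bigr => i _; rewrite (reindex_inj (@perm_inj _ s)).
apply: (@addnI (\sum_(i < n) \sum_(j < n) [&& j < s j, i < j & j < s i])).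
rewrite {2}eq_exc -!big_split /=.
transitivity (\sum_(i < n) \sum_(j < n) ((i < j) && (j < s i))).
  by apply: eq_bigr => i _; rewrite -big_split; apply: eq_bigr => j _ /=; lia.
by rewrite eq_all; apply: eq_bigr => i _; rewrite -big_split; apply: eq_bigr => j _ /=; lia.
Qed.

Lemma crs_ninv_nexc n (s : 'S_n) :
  crs s + ninv s + nexc s = \sum_(i < n) ((s i - i) + (i - s i)).
Proof.
have -> : nexc s = \sum_(i < n) \sum_(j < n) ((i < s i) && (j == s i :> nat)).
  apply: eq_bigr => i _; rewrite (bigD1 (s i)) //= eqxx andbT big1 ?addn0 // => j.
  by rewrite -val_eqE /= => /negbTE->; rewrite andbF.
have -> : \sum_(i < n) ((s i - i) + (i - s i)) =
    \sum_(i < n) \sum_(j < n) (((i < j) && (j <= s i)) + ((s i <= j) && (j < i))).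
  apply: eq_bigr => i _; rewrite big_split (sum_ord_in_Ico _ (ltnW (ltn_ord i))).
  by rewrite -[s i - i]subSS -(sum_ord_in_Ico i.+1 (ltn_ord (s i))).
rewrite /crs card_pairE /ninv.
apply: (@addIn (\sum_(i < n) \sum_(j < n) [&& s j <= j, i < j & j < s i])).
rewrite [X in _ = _ + X]sum_nonexc_under_exc -!big_split /=.
under eq_bigr => i _ do rewrite -!big_split /=.
under [RHS]eq_bigr => i _ do rewrite -!big_split /=.
apply: sum_symmetrize => [i|i j lt_ij]; rewrite /crossing; first by lia.
by have := eqn_perm s i j; case: (ltngtP (s i) (s j)) => ? ?; lia.
Qed.

Lemma crs_rci n (s : 'S_n) : crs (rci s) = crs s.
Proof.
have rev_s_inj := inj_comp (@rev_ord_inj n) (@perm_inj _ s).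
rewrite /crs !card_pairE [RHS]exchange_big (reindex_inj rev_s_inj) /=.
apply: eq_bigr => i _; rewrite (reindex_inj rev_s_inj); apply: eq_bigr => j _.
rewrite /crossing /= !rci_rev !ltn_rev_ord /=.
by have := ltn_ord i; have := ltn_ord j; have := ltn_ord (s i); have := ltn_ord (s j); lia.
Qed.

Lemma nes_rci n (s : 'S_n) : nes (rci s) = nes s.
Proof.
have rev_s_inj := inj_comp (@rev_ord_inj n) (@perm_inj _ s).
rewrite /nes !card_pairE (reindex_inj rev_s_inj) /=.
apply: eq_bigr => i _; rewrite (reindex_inj rev_s_inj); apply: eq_bigr => j _.
rewrite /nesting /= !rci_rev !ltn_rev_ord /=.
by have := ltn_ord i; have := ltn_ord j; have := ltn_ord (s i); have := ltn_ord (s j); lia.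
Qed.

Lemma sum_arcs_over_fixpoint n (s : 'S_n) (k : 'I_n) : s k = k ->
  \sum_(i < n) ((i < k) && (k < s i)) = \sum_(i < n) ((k < i) && (s i < k)).
Proof.
move=> sk; have eq_below : \sum_(i < n) (i < k) = \sum_(i < n) (s i < k).
  by rewrite (reindex_inj (@perm_inj _ s)).
apply: (@addIn (\sum_(i < n) (s i < k))); rewrite -{2}eq_below -!big_split /=.
by apply: eq_bigr => i _; have := eqn_perm s i k; rewrite sk; lia.
Qed.

(* Inverting [s] reflects its arcs; only the convention at the fixed points is
   not symmetric. *)
Lemma nes_inv n (s : 'S_n) : nes s^-1%g = nes s.
Proof.
rewrite /nes !card_pairE (reindex_inj (@perm_inj _ s)).
under eq_bigr => i _ do rewrite (reindex_inj (@perm_inj _ s)).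
rewrite exchange_big /=.
have eq_fix : \sum_(i < n) \sum_(j < n) [&& i < j, s j == j & s j < s i] =
              \sum_(i < n) \sum_(j < n) [&& s j < s i, s i == i & i < j].
  rewrite exchange_big; apply: eq_bigr => k _.
  have [sk|_] := eqVneq (s k) k; last by rewrite !big1 // => i _; rewrite andbF.
  rewrite sk; under eq_bigr => i _ do rewrite andTb.
  by rewrite sum_arcs_over_fixpoint //; apply: eq_bigr => i _; rewrite andbC.
apply: (@addIn (\sum_(i < n) \sum_(j < n) [&& i < j, s j == j & s j < s i])).
rewrite {1}eq_fix -!big_split /=; apply: eq_bigr => i _; rewrite -!big_split.
by apply: eq_bigr => j _; rewrite /nesting !permK -!val_eqE /=; lia.
Qed.

(** * Deleting a point of the diagram *)

(* Contribution of the point [(i, j)] to displacements minus excedances, taken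
   with respect to the diagonal [j = i + d]. *)
Definition diag_weight (d : int) (i j : nat) : int :=
  (`|j%:Z - i%:Z - d| - (d < j%:Z - i%:Z)%R%:Z)%R.

(* The last term, which is symmetric under [d |-> - d - 1], makes the change of
   [shifted_crs] under the deletions of the 213 case depend on the height of the
   Dyck path only. *)
Definition shifted_crs n (d : int) (s : 'S_n) : int :=
  (\sum_(i < n) diag_weight d i (s i) - (ninv s)%:Z - d * (d + 1))%R.

Lemma shifted_crs0 n (s : 'S_n) : shifted_crs 0 s = crs s.
Proof.
suff sumE : ((crs s + ninv s)%:Z = \sum_(i < n) diag_weight 0 i (s i))%R.
  by rewrite /shifted_crs -sumE; lia.
apply: (addIr (Posz (nexc s))); rewrite -PoszD crs_ninv_nexc /nexc.
rewrite !(big_morph Posz PoszD (erefl _)) -big_split /=.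
by apply: eq_bigr => i _; rewrite /diag_weight; lia.
Qed.

Lemma ninv_inv n (s : 'S_n) : ninv s^-1%g = ninv s.
Proof.
rewrite /ninv [RHS]exchange_big (reindex_inj (@perm_inj _ s)); apply: eq_bigr => i _ /=.
by rewrite (reindex_inj (@perm_inj _ s)); apply: eq_bigr => j _; rewrite !permK andbC.
Qed.

Lemma shifted_crs_inv n d (s : 'S_n) : shifted_crs d s^-1%g = shifted_crs (- d - 1) s.
Proof.
rewrite /shifted_crs ninv_inv (reindex_inj (@perm_inj _ s)) /=.
have -> : (\sum_(i < n) diag_weight d (s i) (s^-1 (s i))%g =
   \sum_(i < n) diag_weight (- d - 1) i (s i))%R.
  by apply: eq_bigr => i _; rewrite permK /diag_weight; lia.
by rewrite subrK -opprD mulrNN [(d * _)%R]mulrC.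
Qed.

Lemma sum_lift_perm (V : nmodType) m (F : nat -> nat -> V) (a b : 'I_m.+1) (s : 'S_m) :
  (\sum_(i < m.+1) F i (lift_perm a b s i) =
   F a b + \sum_(k < m) F (bump a k) (bump b (s k)))%R.
Proof.
rewrite (bigD1_ord a) //= lift_perm_id; congr (_ + _)%R.
by apply: eq_bigr => k _; rewrite lift_perm_lift.
Qed.

Lemma ninv_lift_perm m (a b : 'I_m.+1) (s : 'S_m) :
  ninv (lift_perm a b s) =
  ninv s + (\sum_(k < m) ((k < a) && (b <= s k)) + \sum_(k < m) ((a <= k) && (s k < b))).
Proof.
rewrite /ninv (bigD1_ord a) //= (bigD1_ord a) //= lift_perm_id ltnn add0n.
under [X in _ + X]eq_bigr => i _ do rewrite (bigD1_ord a) //= lift_perm_id lift_perm_lift.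
rewrite big_split /= addnC -addnA addnCA; congr (_ + _); last congr (_ + _).
- apply: eq_bigr => i _; apply: eq_bigr => j _; rewrite !lift_perm_lift /= /bump.
  by have := eqn_perm s i j; lia.
- by apply: eq_bigr => i _; rewrite /bump; lia.
- by apply: eq_bigr => i _; rewrite lift_perm_lift /= /bump; lia.
Qed.

Lemma ninv_lift_perm_row0 m (b : 'I_m.+1) (s : 'S_m) : ninv (lift_perm ord0 b s) = ninv s + b.
Proof.
rewrite ninv_lift_perm [X in _ + (X + _)]big1 // add0n; congr (_ + _).
by rewrite -[RHS](sum_perm_lt s) // -ltnS.
Qed.

Lemma ninv_lift_perm_max m (a : 'I_m.+1) (s : 'S_m) :
  ninv (lift_perm a ord_max s) = ninv s + (m - a).
Proof.
rewrite ninv_lift_perm [X in _ + (X + _)]big1 => [|k _].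
  rewrite add0n -[m - a](sum_ord_in_Ico a (leqnn m)); congr (_ + _).
  by apply: eq_bigr => k _; rewrite /= !ltn_ord.
by rewrite [ord_max <= _]leqNgt ltn_ord andbF.
Qed.

Definition corner_free n p r (s : 'S_n) : bool := [forall i : 'I_n, (i < p) ==> (r <= s i)].

Lemma corner_freeP p r n (s : 'S_n) :
  reflect (forall i : 'I_n, i < p -> r <= s i) (corner_free p r s).
Proof. by apply: (iffP forallP) => free i; apply/implyP; apply: free. Qed.

Lemma corner_free_inv p r n (s : 'S_n) : corner_free p r s^-1%g = corner_free r p s.
Proof.
suff imp q u (t : 'S_n) : corner_free q u t -> corner_free u q t^-1%g.
  by apply/idP/idP => /imp //; rewrite invgK.
move=> /corner_freeP free; apply/corner_freeP => i; apply: contraTT; rewrite -!ltnNge => /free.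
by rewrite permKV ltnS.
Qed.

Lemma corner_free0l r n (s : 'S_n) : corner_free 0 r s.
Proof. exact/corner_freeP. Qed.

Lemma corner_free0r p n (s : 'S_n) : corner_free p 0 s.
Proof. exact/corner_freeP. Qed.

Lemma shifted_crs_lift_perm_row0 m d p (b : 'I_m.+1) (s : 'S_m) :
  (d < b%:Z)%R -> (b%:Z <= p%:Z + d + 1)%R -> corner_free p b s ->
  shifted_crs d (lift_perm ord0 b s) = (shifted_crs d s + (b%:Z - d - 1))%R.
Proof.
move=> lt_db le_bp /corner_freeP free; have le_bm : b <= m by rewrite -ltnS.
rewrite /shifted_crs ninv_lift_perm_row0 sum_lift_perm.
have -> : (\sum_(k < m) diag_weight d (bump (@ord0 m) k) (bump b (s k)) =
   \sum_(k < m) diag_weight d k (s k) + b%:Z)%R.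
  rewrite -[X in (_ = _ + Posz X)%R](sum_perm_lt s le_bm).
  rewrite (big_morph Posz PoszD (erefl _)) -big_split.
  by apply: eq_bigr => k _; have := free k; rewrite /diag_weight /bump /=; lia.
by rewrite /diag_weight /=; lia.
Qed.

Lemma shifted_crs_lift_perm_origin m d (s : 'S_m) :
  (0 <= d)%R -> shifted_crs d (lift_perm ord0 ord0 s) = (shifted_crs d s + d)%R.
Proof.
move=> d_ge0; have shifted_crsE n (t : 'S_n) : shifted_crs d t = shifted_crs (- d - 1) t^-1%g.
  by rewrite shifted_crs_inv; congr shifted_crs; lia.
rewrite !shifted_crsE lift_permV (shifted_crs_lift_perm_row0 (p := `|d|)) ?corner_free0r //=; lia.
Qed.

Lemma shifted_crs_lift_perm_max m d (a : 'I_m.+1) (s : 'S_m) :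
  (a%:Z + d < m%:Z)%R -> (forall k : 'I_m, k < a -> (k%:Z + d + 2 <= (s k)%:Z)%R) ->
  shifted_crs d (lift_perm a ord_max s) = (shifted_crs (d + 1) s + (a%:Z + d + 1))%R.
Proof.
move=> lt_adm above; have le_am : a <= m by rewrite -ltnS.
rewrite /shifted_crs ninv_lift_perm_max sum_lift_perm.
have -> : (\sum_(k < m) diag_weight d (bump a k) (bump (@ord_max m) (s k)) =
   \sum_(k < m) diag_weight (d + 1) k (s k) + a%:Z)%R.
  rewrite -[X in (_ = _ + Posz X)%R](sum_perm_lt 1%g le_am).
  rewrite (big_morph Posz PoszD (erefl _)) -big_split.
  apply: eq_bigr => k _; have := above k; have := ltn_ord (s k).
  by rewrite perm1 /diag_weight /bump /=; lia.
by rewrite /diag_weight /=; lia.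
Qed.

Lemma reindex_lift_perm (V : nmodType) m (a b : 'I_m.+1) (P : pred 'S_m.+1) (F : 'S_m.+1 -> V) :
  (\sum_(s : 'S_m.+1 | P s && (s a == b)) F s =
   \sum_(s : 'S_m | P (lift_perm a b s)) F (lift_perm a b s))%R.
Proof.
pose restrict (s : 'S_m.+1) (k : 'I_m) : 'I_m := odflt k (unlift (s a) (s (lift a k))).
have restrictE (s : 'S_m.+1) k : lift (s a) (restrict s k) = s (lift a k).
  rewrite /restrict; case: unliftP => [j -> //|/perm_inj/eqP].
  by rewrite eq_sym (negbTE (neq_lift _ _)).
have restrict_inj (s : 'S_m.+1) : injective (restrict s).
  move=> k l eq_kl; apply: (@lift_inj _ a); apply: (@perm_inj _ s).
  by rewrite -!restrictE eq_kl.
rewrite (reindex_onto (lift_perm a b) (fun s : 'S_m.+1 => perm (restrict_inj s))) /= => [|s].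
  apply: eq_bigl => s; rewrite lift_perm_id eqxx andbT.
  case: (P _) => //=; apply/eqP/permP => k; rewrite permE.
  apply: (@lift_inj _ b); have := restrictE (lift_perm a b s) k.
  by rewrite lift_perm_id lift_perm_lift.
move=> /andP[_ /eqP sa]; apply/permP => i; case: (unliftP a i) => [k|] ->.
  by rewrite lift_perm_lift permE -sa restrictE.
by rewrite lift_perm_id.
Qed.

Lemma sum_shifted_crs_inv (V : nmodType) n d (P : pred 'S_n) (F : int -> V) :
  (\sum_(s : 'S_n | P s) F (shifted_crs d s) =
   \sum_(s : 'S_n | P s^-1%g) F (shifted_crs (- d - 1) s))%R.
Proof.
by rewrite (reindex_inj (@invg_inj 'S_n)); apply: eq_bigr => s _; rewrite shifted_crs_inv.
Qed.

(* One step of a reading process: the point [(a, b)] is either kept or deleted,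
   and then rows and columns are exchanged. *)
Lemma sum_shifted_crs_keep_delete (V : nmodType) m (a b : 'I_m.+1) (P keep : pred 'S_m.+1)
    (delete : pred 'S_m) (d d' c : int) (F : int -> V) :
  (forall s, P s && (s a != b) = keep s^-1%g) ->
  (forall s, P (lift_perm a b s) = delete s^-1%g) ->
  (forall s, delete s^-1%g -> shifted_crs d (lift_perm a b s) = shifted_crs d' s + c)%R ->
  (\sum_(s | P s) F (shifted_crs d s) =
   \sum_(s | keep s) F (shifted_crs (- d - 1) s) +
   \sum_(s | delete s) F (shifted_crs (- d' - 1) s + c))%R.
Proof.
move=> keepE deleteE shifted_crsE; rewrite (bigID (fun s : 'S_m.+1 => s a == b)) /= addrC.
congr (_ + _)%R.
  by rewrite (eq_bigl _ _ keepE) sum_shifted_crs_inv; apply: eq_bigl => s; rewrite invgK.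
rewrite reindex_lift_perm.
transitivity (\sum_(s : 'S_m | delete s^-1%g) F (shifted_crs d' s + c))%R.
  by apply: eq_big => s; rewrite deleteE // => /shifted_crsE->.
rewrite (sum_shifted_crs_inv _ _ (fun w => F (w + c)%R)).
by apply: eq_bigl => s; rewrite invgK.
Qed.

(* Sum of [F] over the weights of the paths of length [l] with steps +1 and -1
   from height [H] to height 0 that stay nonnegative; a down step from height [H]
   has weight [H.-1./2]. *)
Fixpoint dyck_sum (V : nmodType) (l H : nat) (F : int -> V) : V :=
  if l is l'.+1 then
    (dyck_sum l' H.+1 F +
     (if H is H'.+1 then dyck_sum l' H' (fun w => F (w + H'./2%:Z)) else 0))%R
  else if H is 0 then F 0%R else 0%R.

Lemma dyck_sum_eq0 (V : nmodType) l H (F : int -> V) : l < H -> dyck_sum l H F = 0%R.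
Proof.
by elim: l H F => [|l IHl] [|H] F //= lt_lH; rewrite !IHl ?addr0 //; lia.
Qed.

(** * Permutations avoiding 321 *)

(* What is left of a 321-avoiding permutation when [p] rows and [r] columns have
   been read whose points are not yet deleted. *)
Definition Av321_corner n p r (s : 'S_n) : bool := avoids s p321 && corner_free p r s.

Lemma Av321_corner_inv p r n (s : 'S_n) : Av321_corner p r s^-1%g = Av321_corner r p s.
Proof. by rewrite /Av321_corner corner_free_inv -{1}invg_p321 avoids_inv. Qed.

Lemma avoids_p321_lift_perm_row0 m p (b : 'I_m.+1) (s : 'S_m) :
  (0 < p) || (b <= 1) -> corner_free p b s ->
  avoids (lift_perm ord0 b s) p321 = avoids s p321.
Proof.
move=> pb /corner_freeP free; apply/idP/idP => [/avoids_lift_perm //|/avoids_p321P no321].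
apply/avoids_p321P => i j k; case: (unliftP ord0 j) => [j'|] -> //.
case: (unliftP ord0 k) => [k'|] -> //; rewrite !lift_perm_lift !ltn_lift.
case: (unliftP ord0 i) => [i'|] ->.
  by rewrite lift_perm_lift !ltn_lift; apply: no321.
rewrite lift_perm_id => _ lt_jk; apply/negP => /andP[lt_skj lt_sjb].
have {lt_sjb} lt_sjb : s j' < b by rewrite /= /bump in lt_sjb; lia.
have p_gt0 : 0 < p by lia.
have m_gt0 : 0 < m by have := ltn_ord j'; lia.
pose top := Ordinal m_gt0; have := free top p_gt0; have [j0|j_gt0] := posnP j'.
  by rewrite (_ : top = j') 1?leqNgt ?lt_sjb //; apply: val_inj.
by have := no321 top j' k' j_gt0 lt_jk; lia.
Qed.

Lemma Av321_corner_delete m p (b : 'I_m.+1) (s : 'S_m) : (0 < p) || (b <= 1) ->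
  Av321_corner p.+1 b (lift_perm ord0 b s) = Av321_corner p b s.
Proof.
move=> pb; rewrite /Av321_corner.
have -> : corner_free p.+1 b (lift_perm ord0 b s) = corner_free p b s.
  apply/corner_freeP/corner_freeP => free i; first have := free (lift ord0 i).
    by rewrite lift_perm_lift /= /bump; lia.
  case: (unliftP ord0 i) => [i'|] ->; last by rewrite lift_perm_id.
  by rewrite lift_perm_lift; have := free i'; rewrite /= /bump; lia.
by apply: andb_id2r => /(avoids_p321_lift_perm_row0 pb).
Qed.

(* A later row [i] of the corner holding the value [b] would give the pattern
   321 with row [0] and the row of the value [0]. *)
Lemma Av321_corner_keep m p (b : 'I_m.+1) (s : 'S_m.+1) : (0 < b) || (p == 0) ->
  Av321_corner p.+1 b s && (s ord0 != b) = Av321_corner p.+1 b.+1 s.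
Proof.
move=> pb; rewrite /Av321_corner -andbA; apply: andb_id2l => /avoids_p321P no321.
apply/andP/corner_freeP => [[/corner_freeP free s0_neq] i lt_ip | free]; last first.
  split; first by apply/corner_freeP => i /free/ltnW.
  by rewrite -val_eqE /= gtn_eqF ?free.
have := free i lt_ip; rewrite leq_eqVlt => /orP[/eqP si|//].
have i_neq0 : i != ord0 by apply: contraNneq s0_neq => <-; rewrite -val_eqE /= si.
pose k := (s^-1 ord0)%g; have sk : s k = ord0 by rewrite permKV.
rewrite -!val_eqE /= in i_neq0 s0_neq.
by have := free ord0 isT; have := free k; have := no321 ord0 i k; rewrite sk /=; lia.
Qed.

Lemma sum_Av321_corner (V : nmodType) n l H (F : int -> V) : l + H = n.*2 ->
  (\sum_(s : 'S_n | Av321_corner (uphalf H) H./2 s) F (shifted_crs (- (odd H)%:Z) s) =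
   dyck_sum l H F)%R.
Proof.
elim: l n H F => [|l IHl] [|m] H F lHn //.
- have -> : H = 0 by lia.
  rewrite (big_pred1 1%g) => [|s]; first by rewrite /shifted_crs /ninv !big_ord0.
  apply/idP/eqP => _; first by apply/permP => -[].
  by rewrite /Av321_corner corner_free0l andbT; apply/avoids_p321P => -[].
- have -> : H = m.+1.*2 by lia.
  rewrite big1 // => s /andP[_ /corner_freeP free].
  by have := free ord0; have := ltn_ord (s ord0); rewrite doubleK uphalf_double /=; lia.
case: H lHn => [|H] lHn.
  rewrite /= addr0 -(IHl m.+1 1); last by lia.
  rewrite sum_shifted_crs_inv; apply: eq_bigl => s.
  by rewrite Av321_corner_inv /Av321_corner !corner_free0l.
have lt_b : uphalf H < m.+1 by lia.
pose b := Ordinal lt_b.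
rewrite (sum_shifted_crs_keep_delete (a := ord0) (b := b) (d' := (- (odd H.+1)%:Z)%R) (c := H./2)
           (keep := Av321_corner (uphalf H).+1 H./2.+1) (delete := Av321_corner (uphalf H) H./2)).
- rewrite /= -(IHl m.+1 H.+2); last by lia.
  rewrite -(IHl m H) /=; last by lia.
  congr (_ + _)%R; apply: eq_bigr => s _; congr (F _); [|congr (_ + _)%R]; congr shifted_crs; lia.
- by move=> s; rewrite Av321_corner_inv -(@Av321_corner_keep _ _ b) //=; lia.
- by move=> s; rewrite Av321_corner_inv -(@Av321_corner_delete _ _ b) //=; lia.
- move=> s; rewrite Av321_corner_inv => /andP[_ free].
  by rewrite (@shifted_crs_lift_perm_row0 _ _ _ b _ _ _ free) /=; lia.
Qed.

(** * Permutations avoiding 213 *)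

Definition ascending n p (s : 'S_n) : bool :=
  [forall i : 'I_n, forall j : 'I_n, (i < j < p) ==> (s i < s j)].

Lemma ascendingP n p (s : 'S_n) :
  reflect (forall i j : 'I_n, i < j -> j < p -> s i < s j) (ascending p s).
Proof.
apply: (iffP forallP) => asc i; last by apply/forallP => j; apply/implyP => /andP[]; apply: asc.
by move=> j lt_ij lt_jp; have /forallP/(_ j) := asc i; rewrite lt_ij lt_jp.
Qed.

Lemma ascending_invP n r (s : 'S_n) :
  reflect (forall i j : 'I_n, s i < s j -> s j < r -> i < j) (ascending r s^-1%g).
Proof.
apply: (iffP (ascendingP _ _)) => asc i j; first by move=> /asc/[apply]; rewrite !permK.
by move=> lt_ij lt_jr; apply: asc; rewrite !permKV.
Qed.

(* What is left of a 213-avoiding permutation when [p] rows and [r] columns of the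
   initial ascending runs of [s] and of its inverse have been read. *)
Definition Av213_runs n p r (s : 'S_n) : bool :=
  [&& p + r <= n, avoids s p213, corner_free p r s, ascending p s & ascending r s^-1%g].

Lemma Av213_runsP n p r (s : 'S_n) :
  reflect [/\ p + r <= n, (forall i j k : 'I_n, i < j -> j < k -> ~~ (s j < s i < s k)),
              (forall i : 'I_n, i < p -> r <= s i),
              (forall i j : 'I_n, i < j -> j < p -> s i < s j)
            & (forall i j : 'I_n, s i < s j -> s j < r -> i < j)]
          (Av213_runs p r s).
Proof.
apply: (iffP and5P) => -[le_n no213 free asc asc_inv]; split=> //.
- exact/avoids_p213P.
- exact/corner_freeP.
- exact/ascendingP.
- exact/ascending_invP.
- exact/avoids_p213P.
- exact/corner_freeP.
- exact/ascendingP.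
- exact/ascending_invP.
Qed.

Lemma Av213_runs_inv n p r (s : 'S_n) : Av213_runs p r s^-1%g = Av213_runs r p s.
Proof.
rewrite /Av213_runs addnC corner_free_inv invgK -{1}invg_p213 avoids_inv.
by rewrite [ascending p _ && _]andbC.
Qed.

Lemma ascending_le1 n p (s : 'S_n) : p <= 1 -> ascending p s.
Proof.
by move=> le_p1; apply/ascendingP => i j lt_ij /leq_trans/(_ le_p1); case: j lt_ij => -[].
Qed.

Lemma Av213_runs_le1 n p (s : 'S_n) :
  p <= n -> p <= 1 -> Av213_runs p 0 s = avoids s p213.
Proof.
by move=> le_pn le_p1; rewrite /Av213_runs addn0 le_pn corner_free0r !ascending_le1 ?andbT.
Qed.

Lemma Av213_runs_above n p r (s : 'S_n) (i : 'I_n) :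
  Av213_runs p r s -> i < p -> i + r <= s i.
Proof.
case/Av213_runsP => _ _ free asc _; case: i => i /=; elim: i => [|i IHi] lt_in lt_ip.
  exact: free.
have := IHi (ltnW lt_in) (ltnW lt_ip); have := asc (Ordinal (ltnW lt_in)) (Ordinal lt_in).
by rewrite /=; lia.
Qed.

Lemma avoids_p213_lift_perm_max m (a : 'I_m.+1) (s : 'S_m) : ascending a s ->
  avoids (lift_perm a ord_max s) p213 = avoids s p213.
Proof.
move=> /ascendingP asc; apply/idP/idP => [/avoids_lift_perm //|/avoids_p213P no213].
apply/avoids_p213P => i j k; case: (unliftP a i) => [i'|] ->; last first.
  by rewrite lift_perm_id [_ < lift_perm _ _ _ k]ltnNge leq_ord andbF.
case: (unliftP a j) => [j'|] ->; last first.
  by rewrite lift_perm_id [ord_max < _]ltnNge leq_ord.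
rewrite !lift_perm_lift !ltn_lift => lt_ij; case: (unliftP a k) => [k'|] ->.
  by rewrite lift_perm_lift !ltn_lift; apply: no213.
by have := asc i' j' lt_ij; rewrite /= /bump; lia.
Qed.

Lemma ascending_lift_perm_max m (a : 'I_m.+1) (s : 'S_m) :
  ascending a.+1 (lift_perm a ord_max s) = ascending a s.
Proof.
apply/ascendingP/ascendingP => asc i j.
  move=> lt_ij lt_ja; have := asc (lift a i) (lift a j).
  by rewrite !lift_perm_lift !ltn_lift /= /bump; apply; lia.
case: (unliftP a i) => [i'|] ->; last by rewrite ltnS; case: ltnP.
case: (unliftP a j) => [j'|] ->; last by rewrite lift_perm_lift lift_perm_id lift_max ltn_ord.
rewrite !lift_perm_lift !ltn_lift => lt_ij lt_ja; apply: asc => //.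
by rewrite /= /bump in lt_ja; lia.
Qed.

Lemma ascending_lift_perm_max_l m r (b : 'I_m.+1) (s : 'S_m) : r <= m ->
  ascending r (lift_perm ord_max b s) = ascending r s.
Proof.
move=> le_rm; apply/ascendingP/ascendingP => asc i j.
  move=> lt_ij lt_jr; have := asc (lift ord_max i) (lift ord_max j).
  by rewrite !lift_perm_lift !ltn_lift lift_max; apply.
case: (unliftP ord_max j) => [j'|] ->; last by rewrite [_ < r]ltnNge le_rm.
case: (unliftP ord_max i) => [i'|] ->; last by rewrite ltnNge leq_ord.
by rewrite !lift_perm_lift !ltn_lift lift_max; apply: asc.
Qed.

Lemma corner_free_lift_perm_max m r (a : 'I_m.+1) (s : 'S_m) : r <= m ->
  corner_free a.+1 r (lift_perm a ord_max s) = corner_free a r s.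
Proof.
move=> le_rm; apply/corner_freeP/corner_freeP => free i.
  by have := free (lift a i); rewrite lift_perm_lift lift_max /= /bump; lia.
case: (unliftP a i) => [i'|] ->; last by rewrite lift_perm_id.
by rewrite lift_perm_lift lift_max /= /bump; have := free i'; lia.
Qed.

Lemma Av213_runs_delete_max m r (a : 'I_m.+1) (s : 'S_m) :
  Av213_runs a.+1 r (lift_perm a ord_max s) = Av213_runs a r s.
Proof.
rewrite /Av213_runs addSn ltnS; apply: andb_id2l => le_arm.
have le_rm : r <= m by lia.
rewrite lift_permV ascending_lift_perm_max ascending_lift_perm_max_l //.
rewrite corner_free_lift_perm_max //.
rewrite [RHS]andbC [LHS]andbC; apply: andb_id2l => /and3P[_ asc _].
exact: avoids_p213_lift_perm_max.
Qed.

(* In a 213-avoiding permutation the initial ascending run ends with the maximum. *)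
Lemma Av213_runs_keep_max m r (a : 'I_m.+1) (s : 'S_m.+1) :
  Av213_runs a.+1 r s && (s a != ord_max) = Av213_runs a.+2 r s.
Proof.
apply/andP/idP => [[runs sa_neq]|/Av213_runsP[le_n no213 free asc asc_inv]]; last first.
  split.
    apply/Av213_runsP; split=> // [|i lt_i|i j lt_ij lt_j]; first by lia.
      by apply: free; lia.
    by apply: asc; lia.
  have lt_next : a.+1 < m.+1 by lia.
  have := asc a (Ordinal lt_next) (leqnn _) (leqnn _).
  by rewrite -val_eqE /=; have := leq_ord (s (Ordinal lt_next)); lia.
have := Av213_runs_above runs (leqnn _); case/Av213_runsP: runs => _ no213 free asc asc_inv le_sa.
pose k := (s^-1 ord_max)%g; have sk : s k = ord_max by rewrite permKV.
have lt_sa : s a < m by have := leq_ord (s a); rewrite -val_eqE /= in sa_neq; lia.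
have lt_ak : a < k.
  have [//|lt_ka|/val_inj eq_ak] := ltngtP a k; last by rewrite eq_ak sk eqxx in sa_neq.
  by have := asc k a lt_ka (leqnn _); rewrite sk /=; lia.
have lt_next : a.+1 < m.+1 by have := leq_ord k; lia.
pose next := Ordinal lt_next.
have lt_s_next : s a < s next.
  have [->|next_neqk] := eqVneq next k; first by rewrite sk.
  have := eqn_perm s a next; have := no213 a next k (leqnn _); rewrite sk /=.
  by rewrite -val_eqE /= in next_neqk; lia.
have upto_next (i : 'I_m.+1) : i < a.+2 -> i < a.+1 \/ i = next.
  by rewrite ltnS leq_eqVlt => /orP[/eqP eq_i|]; [right; apply: val_inj | left].
apply/Av213_runsP; split=> //.
- by have := leq_ord (s next); lia.
- by move=> i /upto_next[/free//|->]; lia.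
- move=> i j lt_ij /upto_next[/asc|eq_j]; first exact.
  rewrite eq_j /= in lt_ij *; have [lt_ia|le_ai] := ltnP i a; first by have := asc i a lt_ia; lia.
  by have -> : i = a by apply: val_inj => /=; lia.
Qed.

Lemma ascending_lift_perm_origin m r (s : 'S_m) :
  ascending r.+1 (lift_perm ord0 ord0 s) = ascending r s.
Proof.
apply/ascendingP/ascendingP => asc i j.
  move=> lt_ij lt_jr; have := asc (lift ord0 i) (lift ord0 j).
  by rewrite !lift_perm_lift !ltn_lift; apply.
case: (unliftP ord0 j) => [j'|] -> //; rewrite lift_perm_lift.
case: (unliftP ord0 i) => [i'|] ->; rewrite ?lift_perm_lift ?lift_perm_id // !ltn_lift.
exact: asc.
Qed.

Lemma avoids_p213_lift_perm_origin m (s : 'S_m) :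
  avoids (lift_perm ord0 ord0 s) p213 = avoids s p213.
Proof.
apply/idP/idP => [/avoids_lift_perm //|/avoids_p213P no213].
apply/avoids_p213P => i j k; case: (unliftP ord0 j) => [j'|] -> //.
case: (unliftP ord0 k) => [k'|] -> //; rewrite !lift_perm_lift !ltn_lift.
case: (unliftP ord0 i) => [i'|] ->; last by rewrite lift_perm_id.
by rewrite lift_perm_lift !ltn_lift; apply: no213.
Qed.

Lemma Av213_runs_delete_origin m r (s : 'S_m) :
  Av213_runs 0 r.+1 (lift_perm ord0 ord0 s) = Av213_runs 0 r s.
Proof.
rewrite /Av213_runs !corner_free0l !(@ascending_le1 _ 0) // lift_permV ascending_lift_perm_origin.
by rewrite avoids_p213_lift_perm_origin.
Qed.

Lemma Av213_runs_keep_origin m r (s : 'S_m.+1) :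
  Av213_runs 0 r.+1 s && (s ord0 != ord0) = Av213_runs 1 r.+1 s.
Proof.
apply/andP/Av213_runsP => [[/Av213_runsP[le_n no213 _ _ asc_inv] s0_neq]|]; last first.
  case=> le_n no213 free _ asc_inv; split; first by apply/Av213_runsP; split=> //; lia.
  by have := free ord0 isT; rewrite -val_eqE /=; lia.
have lt_rs0 : r < s ord0.
  rewrite -val_eqE /= in s0_neq; rewrite ltnNge; apply/negP => le_s0r.
  by have := asc_inv (s^-1 ord0)%g ord0; rewrite permKV ltnS le_s0r lt0n s0_neq => /(_ isT isT).
split=> // [|i|i j lt_ij]; first by have := leq_ord (s ord0); lia.
  by rewrite ltnS leqn0 => /eqP i0; rewrite (_ : i = ord0) //; apply: val_inj.
by rewrite ltnS leqn0 => /eqP j0; rewrite j0 in lt_ij.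
Qed.

Lemma sum_Av213_runs_origin (V : nmodType) m r d (F : int -> V) : (0 <= d)%R ->
  (\sum_(s : 'S_m.+1 | Av213_runs 0 r.+1 s) F (shifted_crs d s) =
   \sum_(s : 'S_m.+1 | Av213_runs r.+1 1 s) F (shifted_crs (- d - 1) s) +
   \sum_(s : 'S_m | Av213_runs r 0 s) F (shifted_crs (- d - 1) s + d))%R.
Proof.
move=> d_ge0; apply: (sum_shifted_crs_keep_delete (a := ord0) (b := ord0)) => s.
- by rewrite Av213_runs_inv Av213_runs_keep_origin.
- by rewrite Av213_runs_inv Av213_runs_delete_origin.
- by rewrite shifted_crs_lift_perm_origin.
Qed.

Lemma sum_Av213_runs_max (V : nmodType) m p r d (F : int -> V) :
  p <= m -> (p%:Z + d < m%:Z)%R -> (d + 2 <= r%:Z)%R || (p == 0) ->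
  (\sum_(s : 'S_m.+1 | Av213_runs p.+1 r s) F (shifted_crs d s) =
   \sum_(s : 'S_m.+1 | Av213_runs r p.+2 s) F (shifted_crs (- d - 1) s) +
   \sum_(s : 'S_m | Av213_runs r p s) F (shifted_crs (- (d + 1) - 1) s + (p%:Z + d + 1)))%R.
Proof.
rewrite -ltnS => lt_p lt_pd le_dr; pose a := Ordinal lt_p.
apply: (sum_shifted_crs_keep_delete (a := a) (b := ord_max)) => s.
- by rewrite Av213_runs_inv -(Av213_runs_keep_max r a).
- by rewrite Av213_runs_inv -(Av213_runs_delete_max r a).
rewrite Av213_runs_inv => runs; apply: shifted_crs_lift_perm_max => // k lt_k.
by have := Av213_runs_above runs lt_k; rewrite /= in lt_k; lia.
Qed.

(* The choice of [d] makes the weight of the next deletion depend on [p + r] only. *)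
Lemma sum_Av213_runs (V : nmodType) n l p r d (F : int -> V) :
  l + (p + r) = n.*2 -> (r%:Z + (odd (p + r))%:Z = p%:Z + d * 2 + 2)%R ->
  (\sum_(s : 'S_n | Av213_runs p r s) F (shifted_crs d s) = dyck_sum l (p + r) F)%R.
Proof.
elim: l n p r d F => [|l IHl] n p r d F ln dE;
  (have [lt_npr|le_prn] := ltnP n (p + r);
     first by rewrite dyck_sum_eq0 ?big1 // => [s /and5P[le_prn _ _ _ _]|]; lia).
- have [-> -> -> ->] : [/\ n = 0, p = 0, r = 0 & d = (-1)%R] by split; lia.
  rewrite (big_pred1 1%g) => [|s]; first by rewrite /shifted_crs /ninv !big_ord0.
  rewrite Av213_runs_le1 //; apply/idP/eqP => _; first by apply/permP => -[].
  by apply/avoids_p213P => -[].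
case: n ln le_prn => [|m] ln le_prn; first by lia.
case: p ln dE le_prn => [|p] ln dE le_prn.
  case: r ln dE le_prn => [|r] ln dE le_prn.
    rewrite /= addr0 -(IHl m.+1 1 0 d F) //; try lia.
    by apply: eq_bigl => s; rewrite !Av213_runs_le1.
  rewrite sum_Av213_runs_origin /=; last by lia.
  have -> : (d = r./2%:Z)%R by lia.
  rewrite (IHl m.+1 r.+1 1) ?addn1; [|lia|lia].
  by rewrite (IHl m r 0 _ (fun w => F (w + _)%R)) ?addn0; [|lia|lia].
rewrite sum_Av213_runs_max; [|lia|lia|lia].
rewrite (IHl m.+1 r p.+2); [|lia|lia].
rewrite (IHl m r p _ (fun w => F (w + _)%R)); [|lia|lia].
have -> : (p%:Z + d + 1 = (p + r)./2%:Z)%R by lia.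
by rewrite !addnS ![r + _]addnC.
Qed.

Lemma sum_crs_avoiding_213_321 (V : nmodType) n (F : int -> V) :
  (\sum_(s : 'S_n | avoids s p213) F (crs s) = \sum_(s : 'S_n | avoids s p321) F (crs s))%R.
Proof.
transitivity (dyck_sum n.*2 0 F).
  rewrite -(sum_Av213_runs (n := n) (p := 0) (r := 0) (d := -1)) ?addn0 // sum_shifted_crs_inv.
  apply: eq_big => s; first by rewrite Av213_runs_inv Av213_runs_le1.
  by rewrite opprK subrr shifted_crs0.
rewrite -(sum_Av321_corner (n := n)) ?addn0 //.
apply: eq_big => s; first by rewrite /Av321_corner corner_free0l andbT.
by rewrite oppr0 shifted_crs0.
Qed.

(** * Wilf equivalence *)

Lemma mem_Av1 n k (t : 'S_k) (s : 'S_n) : (s \in Av n [:: Pattern t]) = avoids s t.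
Proof. by rewrite inE /= andbT. Qed.

Lemma wilf_equiv_sym m (st : m.-tuple statistic) T U : wilf_equiv st T U -> wilf_equiv st U T.
Proof. by move=> eq_TU n n_gt0; rewrite eq_TU. Qed.

Lemma wilf_equiv_trans m (st : m.-tuple statistic) T U W :
  wilf_equiv st T U -> wilf_equiv st U W -> wilf_equiv st T W.
Proof. by move=> eq_TU eq_UW n n_gt0; rewrite eq_TU ?eq_UW. Qed.

Lemma wilf_equiv_reindex m (st : m.-tuple statistic) k l (t : 'S_k) (u : 'S_l)
    (f : forall n, 'S_n -> 'S_n) :
  (forall n, injective (@f n)) ->
  (forall n (s : 'S_n), avoids (f n s) u = avoids s t) ->
  (forall i n (s : 'S_n), tnth st i n (f n s) = tnth st i n s) ->
  wilf_equiv st [:: Pattern t] [:: Pattern u].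
Proof.
move=> f_inj f_avoids f_st n _; rewrite /genpoly [RHS](reindex_inj (f_inj n)) /=.
apply: eq_big => s; first by rewrite !mem_Av1 f_avoids.
by move=> _; apply: eq_bigr => i _; rewrite f_st.
Qed.

Lemma wilf_equiv_rci m (st : m.-tuple statistic) k (t : 'S_k) :
  (forall i n (s : 'S_n), tnth st i n (rci s) = tnth st i n s) ->
  wilf_equiv st [:: Pattern t] [:: Pattern (rci t)].
Proof.
move=> st_rci; apply: (wilf_equiv_reindex (f := rci)) => // n; first exact: inv_inj (@rciK n).
by move=> s; rewrite avoids_rci.
Qed.

Lemma wilf_equiv_inv m (st : m.-tuple statistic) k (t : 'S_k) :
  (forall i n (s : 'S_n), tnth st i n s^-1%g = tnth st i n s) ->
  wilf_equiv st [:: Pattern t] [:: Pattern t^-1%g].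
Proof.
move=> st_inv; apply: (wilf_equiv_reindex (f := fun n s => s^-1%g)) => // n; first exact: invg_inj.
by move=> s; rewrite avoids_inv.
Qed.

Lemma wilf_equiv_crs_213_321 : wilf_equiv [tuple crs] [:: Pattern p213] [:: Pattern p321].
Proof.
move=> n _; pose F (w : int) : {mpoly int[1]} := ('X_ord0 ^+ `|w|%N)%R.
have genpolyE t : genpoly [tuple crs] n [:: Pattern t] =
    (\sum_(s : 'S_n | avoids s t) F (crs s))%R.
  apply: eq_big => s; first exact: mem_Av1.
  by rewrite big_ord1 (tnth_nth (@crs)).
by rewrite !genpolyE sum_crs_avoiding_213_321.
Qed.

Lemma tnth_crs_rci i n (s : 'S_n) : tnth [tuple crs] i n (rci s) = tnth [tuple crs] i n s.
Proof. by rewrite (tnth_nth (@crs)) ord1 /= crs_rci. Qed.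

Lemma tnth_nes_rci i n (s : 'S_n) : tnth [tuple nes] i n (rci s) = tnth [tuple nes] i n s.
Proof. by rewrite (tnth_nth (@nes)) ord1 /= nes_rci. Qed.

Lemma tnth_crs_nes_rci i n (s : 'S_n) :
  tnth [tuple crs; nes] i n (rci s) = tnth [tuple crs; nes] i n s.
Proof.
by rewrite (tnth_nth (@nes)); case: i => -[|[|i]] //= _; rewrite ?crs_rci ?nes_rci.
Qed.

Lemma tnth_nes_inv i n (s : 'S_n) : tnth [tuple nes] i n s^-1%g = tnth [tuple nes] i n s.
Proof. by rewrite (tnth_nth (@nes)) ord1 /= nes_inv. Qed.

(* Value at [X_i = i + 2] of the generating polynomial. *)
Definition genval m (st : m.-tuple statistic) n k (t : 'S_k) : nat :=
  \sum_(s : 'S_n | avoids s t) \prod_(i < m) (i + 2) ^ tnth st i n s.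

Lemma wilf_equiv_genval m (st : m.-tuple statistic) n k l (t : 'S_k) (u : 'S_l) :
  0 < n -> wilf_equiv st [:: Pattern t] [:: Pattern u] -> genval st n t = genval st n u.
Proof.
move=> n_gt0 /(_ n n_gt0)/(congr1 (meval (fun i : 'I_m => (i + 2)%:R : int)%R)).
have evalE j (v : 'S_j) :
    ((genpoly st n [:: Pattern v]).@[fun i : 'I_m => (i + 2)%:R : int] = (genval st n v)%:R)%R.
  rewrite rmorph_sum natr_sum; apply: eq_big => s; first exact: mem_Av1.
  move=> _; rewrite rmorph_prod natr_prod; apply: eq_bigr => i _.
  by rewrite rmorphXn natrX /= mevalXU.
by rewrite !evalE => /eqP; rewrite eqr_nat => /eqP.
Qed.

(** * Computing with one-line words *)

Lemma size_word n (s : 'S_n) : size (word s) = n.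
Proof. by rewrite size_map size_enum_ord. Qed.

Lemma perm_word_permutations n :
  perm_eq [seq word s | s <- index_enum {perm 'I_n}] (permutations (iota 1 n)).
Proof.
have uniq_words : uniq [seq word s | s <- index_enum {perm 'I_n}].
  by rewrite (map_inj_uniq (@word_inj n)) index_enum_uniq.
have sub : {subset [seq word s | s <- index_enum {perm 'I_n}] <= permutations (iota 1 n)}.
  move=> w /mapP[s _ ->]; rewrite mem_permutations; apply: uniq_perm; last move=> k.
  - by rewrite map_inj_uniq ?enum_uniq // => i j /succn_inj/val_inj/perm_inj.
  - exact: iota_uniq.
  rewrite mem_iota add1n ltnS; apply/mapP/andP => [[i _ ->] | [k_gt0 le_kn]] //.
  have lt_kn : k.-1 < n by rewrite prednK.
  by exists (s^-1 (Ordinal lt_kn))%g; rewrite ?mem_enum // permKV /= prednK.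
apply: uniq_perm => //; first exact: permutations_uniq.
apply: (uniq_min_size uniq_words sub _).2.
rewrite size_permutations ?iota_uniq // size_iota size_map.
by rewrite [index_enum _]unlock -enumT -cardT card_Sn.
Qed.

Lemma sum_word n (P : pred (seq nat)) (F : seq nat -> nat) :
  \sum_(s : 'S_n | P (word s)) F (word s) = sumn [seq F w | w <- permutations (iota 1 n) & P w].
Proof. by rewrite sumnE big_map big_filter -(perm_big _ (perm_word_permutations n)) big_map. Qed.

Lemma sum_ord_sumn n (F : nat -> nat) : \sum_(i < n) F i = sumn [seq F i | i <- iota 0 n].
Proof. by rewrite sumnE big_map -(big_mkord xpredT F) /index_iota subn0. Qed.

Lemma all_iota_ord n (p : pred nat) : all p (iota 0 n) = [forall i : 'I_n, p i].
Proof.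
apply/allP/forallP => [all_p i|all_p k]; first by apply: all_p; rewrite mem_iota /=.
by rewrite mem_iota => lt_kn; apply: (all_p (Ordinal lt_kn)).
Qed.

Definition count_pairs_word (c : nat -> nat -> nat -> nat -> bool) (w : seq nat) : nat :=
  let value i := (nth 0 w i).-1 in
  sumn [seq sumn [seq nat_of_bool (c i j (value i) (value j)) | j <- iota 0 (size w)]
          | i <- iota 0 (size w)].

Lemma count_pairs_wordE n (c : nat -> nat -> nat -> nat -> bool) (s : 'S_n) :
  #|[set p : 'I_n * 'I_n | c p.1 p.2 (s p.1) (s p.2)]| = count_pairs_word c (word s).
Proof.
rewrite (card_pairE (fun i j => c i j (s i) (s j))) /count_pairs_word size_word -sum_ord_sumn.
by apply: eq_bigr => i _; rewrite -sum_ord_sumn; apply: eq_bigr => j _; rewrite !nth_word.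
Qed.

Definition crs_word := count_pairs_word (fun i j a b =>
  [&& i < j, j < a & a < b] || [&& a < b, b <= i & i < j]).

Definition nes_word := count_pairs_word (fun i j a b =>
  [&& i < j, j < b & b < a] || [&& b < a, a <= i & i < j]).

Lemma crs_wordE n (s : 'S_n) : crs s = crs_word (word s).
Proof. by rewrite /crs_word -count_pairs_wordE. Qed.

Lemma nes_wordE n (s : 'S_n) : nes s = nes_word (word s).
Proof. by rewrite /nes_word -count_pairs_wordE. Qed.

Definition avoids_word (v w : seq nat) : bool :=
  let entry := nth 0 w in let positions := iota 0 (size w) in
  all (fun i => all (fun j => all (fun k =>
    [&& i < j & j < k] ==> (red [:: entry i; entry j; entry k] != v))
    positions) positions) positions.

Lemma avoids_wordE n (s : 'S_n) (t : 'S_3) : avoids s t = avoids_word (word t) (word s).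
Proof.
rewrite /avoids_word size_word all_iota_ord; apply/avoids_S3P/forallP => avoid i.
  rewrite all_iota_ord; apply/forallP => j; rewrite all_iota_ord; apply/forallP => k.
  by rewrite !nth_word; apply/implyP => /andP[]; apply: avoid.
move=> j k lt_ij lt_jk; move: (avoid i); rewrite all_iota_ord => /forallP/(_ j).
by rewrite all_iota_ord => /forallP/(_ k); rewrite !nth_word lt_ij lt_jk.
Qed.

Lemma genval_word m (st : m.-tuple statistic) n (g : seq nat -> nat) (t : 'S_3) :
  (forall s : 'S_n, \prod_(i < m) (i + 2) ^ tnth st i n s = g (word s)) ->
  genval st n t = sumn [seq g w | w <- permutations (iota 1 n) & avoids_word (word t) w].
Proof. by move=> stE; rewrite -sum_word; apply: eq_big => s; rewrite ?stE ?avoids_wordE. Qed.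

Definition patterns3 : seq 'S_3 := [:: p123; p132; p213; p231; p312; p321].

Definition words3 : seq (seq nat) :=
  [:: [:: 1; 2; 3]; [:: 1; 3; 2]; [:: 2; 1; 3]; [:: 2; 3; 1]; [:: 3; 1; 2]; [:: 3; 2; 1]].

Lemma map_word_patterns3 : [seq word t | t <- patterns3] = words3.
Proof. by rewrite /= !words_S3E. Qed.

Lemma genval_patterns3 m (st : m.-tuple statistic) n (g : seq nat -> nat) :
  (forall s : 'S_n, \prod_(i < m) (i + 2) ^ tnth st i n s = g (word s)) ->
  [seq genval st n t | t <- patterns3] =
  [seq sumn [seq g w | w <- permutations (iota 1 n) & avoids_word v w] | v <- words3].
Proof.
by move=> stE; rewrite -map_word_patterns3 -map_comp; apply: eq_map => t; apply: genval_word.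
Qed.

Lemma genval4_nes :
  [seq genval [tuple nes] 4 t | t <- patterns3] = [:: 28; 25; 25; 22; 22; 14].
Proof.
rewrite (@genval_patterns3 _ _ 4 (fun w => 2 ^ nes_word w)); first by vm_compute.
by move=> s; rewrite big_ord1 -nes_wordE.
Qed.

Lemma genval4_crs :
  [seq genval [tuple crs] 4 t | t <- patterns3] = [:: 23; 24; 24; 22; 15; 24].
Proof.
rewrite (@genval_patterns3 _ _ 4 (fun w => 2 ^ crs_word w)); first by vm_compute.
by move=> s; rewrite big_ord1 -crs_wordE.
Qed.

Lemma genval4_crs_nes :
  [seq genval [tuple crs; nes] 4 t | t <- patterns3] = [:: 63; 56; 56; 46; 35; 24].
Proof.
rewrite (@genval_patterns3 _ _ 4 (fun w => 2 ^ crs_word w * 3 ^ nes_word w)).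
  by vm_compute.
by move=> s; rewrite big_ord_recr big_ord1 -crs_wordE -nes_wordE.
Qed.

(** * Wilf classes of S_3 *)

Lemma eq_perm_word n (s t : 'S_n) : (s == t) = (word s == word t).
Proof. by rewrite (inj_eq (@word_inj n)). Qed.

Lemma mem_patterns3 t : t \in patterns3.
Proof.
have uniq_patterns3 : uniq patterns3 by rewrite -(map_inj_uniq (@word_inj 3)) /= !words_S3E.
have sub : {subset patterns3 <= enum 'S_3} by move=> s _; rewrite mem_enum.
by rewrite (uniq_min_size uniq_patterns3 sub _).2 ?mem_enum // -cardE card_Sn.
Qed.

Lemma patterns3_ind (P : 'S_3 -> Prop) :
  P p123 -> P p132 -> P p213 -> P p231 -> P p312 -> P p321 -> forall t, P t.
Proof.
move=> P123 P132 P213 P231 P312 P321 t; have := mem_patterns3 t.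
by rewrite !inE; do 5?[case/orP => [/eqP->//|]]; move/eqP->.
Qed.

(* The class of [t] in the partition whose blocks are the members of [As] and
   singletons. *)
Definition block (T : finType) (As : seq {set T}) (t : T) : {set T} :=
  head [set t] [seq A : {set T} <- As | t \in A].

Lemma block_notin (T : finType) (As : seq {set T}) t :
  {in As, forall A : {set T}, t \notin A} -> block As t = [set t].
Proof.
move=> notinAs; rewrite /block (_ : [seq A : {set T} <- As | t \in A] = [::]) //.
by apply/eqP; rewrite -[_ == _]negbK -has_filter; apply/hasPn.
Qed.

Lemma block_in (T : finType) (As : seq {set T}) (A : {set T}) t :
  pairwise (fun B C : {set T} => [disjoint B & C]) As -> A \in As -> t \in A -> block As t = A.
Proof.
rewrite /block; elim: As => //= B As IHAs /andP[/allP B_disj As_disj].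
rewrite inE => /orP[/eqP->|A_in] tA; first by rewrite tA.
by rewrite (disjointFl (B_disj A A_in)) // IHAs.
Qed.

Variant block_spec (T : finType) (As : seq {set T}) (t : T) : {set T} -> Prop :=
  | BlockIn (A : {set T}) of A \in As & t \in A : block_spec As t A
  | BlockSingleton : block_spec As t [set t].

Lemma blockP (T : finType) (As : seq {set T}) t : block_spec As t (block As t).
Proof.
rewrite /block; case E : [seq A : {set T} <- As | t \in A] => [|A Bs]; first exact: BlockSingleton.
have : A \in [seq A : {set T} <- As | t \in A] by rewrite E mem_head.
by rewrite mem_filter => /andP[tA A_in]; apply: BlockIn.
Qed.

Section Blocks.
Variables (m k : nat) (st : m.-tuple statistic) (As : seq {set 'S_k}).
Hypothesis equivE : forall t u, wilf_equiv st [:: Pattern t] [:: Pattern u] <-> u \in block As t.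

Lemma is_wilf_class_block t : is_wilf_class st (block As t).
Proof. by exists t => u; rewrite equivE. Qed.

Lemma nontrivial_wilf_class (C : {set 'S_k}) :
  pairwise (fun A B : {set 'S_k} => [disjoint A & B]) As ->
  all (fun A : {set 'S_k} => 1 < #|A|) As ->
  is_wilf_class st C /\ 1 < #|C| <-> C \in As.
Proof.
move=> As_disj /allP As_big; split=> [[[t Ct] C_big] | C_in].
  have defC : C = block As t by apply/setP => u; apply/idP/idP => [/Ct/equivE|/equivE/Ct].
  by move: C_big; rewrite defC; case: blockP => // ; rewrite cards1.
have C_big := As_big C C_in; split=> //.
have /card_gt0P[t tC] := ltnW C_big.
by rewrite -(block_in As_disj C_in tC); apply: is_wilf_class_block.
Qed.

End Blocks.

Lemma wilf_equiv_block m (st : m.-tuple statistic) n (As : seq {set 'S_3}) :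
  0 < n -> (forall t u, genval st n t = genval st n u -> u \in block As t) ->
  {in As, forall A : {set 'S_3}, exists t : 'S_3,
    {in A, forall u, wilf_equiv st [:: Pattern t] [:: Pattern u]}} ->
  forall t u, wilf_equiv st [:: Pattern t] [:: Pattern u] <-> u \in block As t.
Proof.
move=> n_gt0 separated As_equiv t u; split=> [/(wilf_equiv_genval n_gt0)/separated //|].
case: blockP => [A /As_equiv[v v_equiv] tA uA | ]; last by rewrite inE => /eqP->.
exact: wilf_equiv_trans (wilf_equiv_sym (v_equiv t tA)) (v_equiv u uA).
Qed.

Definition nes_blocks : seq {set 'S_3} := [:: [set p132; p213]; [set p231; p312]].

Definition crs_blocks : seq {set 'S_3} := [:: [set p132; p213; p321]].

Definition crs_nes_blocks : seq {set 'S_3} := [:: [set p132; p213]].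

Local Ltac separate_patterns genvalE :=
  do 2![elim/patterns3_ind]; rewrite ?genvalE // => _;
  by rewrite /block /= !inE !eq_perm_word !words_S3E /= !inE ?eqxx ?orbT.

Lemma wilf_equiv_nes t u :
  wilf_equiv [tuple nes] [:: Pattern t] [:: Pattern u] <-> u \in block nes_blocks t.
Proof.
move: t u; apply: (@wilf_equiv_block _ _ 4) => // [|A].
  case: genval4_nes => e123 e132 e213 e231 e312 e321.
  separate_patterns (e123, e132, e213, e231, e312, e321).
rewrite !inE => /orP[]/eqP->.
  exists p132 => u /set2P[]-> //; rewrite -rci_p132; exact: wilf_equiv_rci tnth_nes_rci.
exists p231 => u /set2P[]-> //; rewrite -invg_p231; exact: wilf_equiv_inv tnth_nes_inv.
Qed.

Lemma wilf_equiv_crs t u :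
  wilf_equiv [tuple crs] [:: Pattern t] [:: Pattern u] <-> u \in block crs_blocks t.
Proof.
move: t u; apply: (@wilf_equiv_block _ _ 4) => // [|A].
  case: genval4_crs => e123 e132 e213 e231 e312 e321.
  separate_patterns (e123, e132, e213, e231, e312, e321).
rewrite inE => /eqP->; exists p213 => u; rewrite !inE => /orP[/orP[]|]/eqP-> //.
  by apply: wilf_equiv_sym; rewrite -rci_p132; apply: wilf_equiv_rci tnth_crs_rci.
exact: wilf_equiv_crs_213_321.
Qed.

Lemma wilf_equiv_crs_nes t u :
  wilf_equiv [tuple crs; nes] [:: Pattern t] [:: Pattern u] <-> u \in block crs_nes_blocks t.
Proof.
move: t u; apply: (@wilf_equiv_block _ _ 4) => // [|A].
  case: genval4_crs_nes => e123 e132 e213 e231 e312 e321.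
  separate_patterns (e123, e132, e213, e231, e312, e321).
rewrite inE => /eqP->; exists p132 => u /set2P[]-> //.
by rewrite -rci_p132; apply: wilf_equiv_rci tnth_crs_nes_rci.
Qed.

Theorem theorem1p1 :
  [/\ (forall C : {set 'S_3},
         is_wilf_class [tuple nes] C /\ 1 < #|C| <->
         C = [set p132; p213] \/ C = [set p231; p312])
      /\ (forall t : 'S_3,
            t \notin [set p132; p213] -> t \notin [set p231; p312] ->
            is_wilf_class [tuple nes] [set t]),
      (forall C : {set 'S_3},
         is_wilf_class [tuple crs] C /\ 1 < #|C| <->
         C = [set p132; p213; p321])
    & (forall C : {set 'S_3},
         is_wilf_class [tuple crs; nes] C /\ 1 < #|C| <->
         C = [set p132; p213])].
Proof.
have neq_132_213 : p132 != p213 by rewrite eq_perm_word !words_S3E.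
have neq_231_312 : p231 != p312 by rewrite eq_perm_word !words_S3E.
split; first split.
- move=> C; rewrite (nontrivial_wilf_class wilf_equiv_nes) /= ?cards2 ?neq_132_213 ?neq_231_312 //.
    by rewrite !inE; split=> /pred2P.
  rewrite !andbT; apply/pred0P; elim/patterns3_ind; by rewrite /= !inE !eq_perm_word !words_S3E.
- move=> t t_notin1 t_notin2; rewrite -(@block_notin _ nes_blocks) => [|A].
    exact: is_wilf_class_block wilf_equiv_nes t.
  by rewrite !inE => /orP[]/eqP->.
- move=> C; rewrite (nontrivial_wilf_class wilf_equiv_crs) //= ?inE; first by split=> /eqP.
  by rewrite andbT; apply/card_gt1P; exists p132, p213; rewrite !inE !eqxx ?orbT.
- move=> C; rewrite (nontrivial_wilf_class wilf_equiv_crs_nes) /= ?cards2 ?neq_132_213 //.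
  by rewrite inE; split=> /eqP.
Qed.
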